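(* Let $1\le p\le2$ with Hölder conjugate $q$, $0<\epsilon<1$, $0<\delta<1/2$, and $2\le n\le1/\epsilon^q$. Any algorithm that solves the uniformity testing problem for $\ell_p$ distance with tolerance $\epsilon$ and failure probability $\delta$ on support size $n$ must draw at least \[ m=\sqrt{\ln\left((1-2\delta)^2+1\right)}\,\frac{\sqrt n}{(\epsilon n^{1/q})^2}\] samples.
   Context: A distribution on support size $n$ is a vector $A\in\mathbb{R}^n$, $A_i\ge0$, $\sum_iA_i=1$; $U_n$ is uniform; $\|V\|_p=(\sum_i|V_i|^p)^{1/p}$. Uniformity testing: given $p,n,\epsilon,\delta$ and i.i.d. samples from an unknown distribution $A$ on $\{1,\dots,n\}$, the algorithm draws $m$ samples and must output ``uniform'' with probability at least $1-\delta$ if $A=U_n$, and ``not uniform'' with probability at least $1-\delta$ if $\|A-U_n\|_p\ge\epsilon$. Hölder conjugate: $q=p/(p-1)$ for $1<p\le2$, $q=\infty$ for $p=1$; when $q=\infty$, $n^{1/q}=1$ and $n\le1/\epsilon^q$ holds for every $n$. *)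

(* Defs.v *)
From HB Require Import structures.
From mathcomp Require Import all_boot all_order all_algebra.
From mathcomp Require Import boolp reals ereal exp hoelder.

Set Implicit Arguments.
Unset Strict Implicit.
Unset Printing Implicit Defensive.

Import Order.TTheory GRing.Theory Num.Theory.
Local Open Scope ring_scope.

Definition is_distribution (R : realType) (T : finType) (A : {ffun T -> R}) :
    Prop :=
  (forall x, 0 <= A x) /\ \sum_x A x = 1.

Definition uniform (R : realType) (n : nat) : {ffun 'I_n -> R} :=
  [ffun=> n%:R^-1].

Definition lp_norm (R : realType) (n : nat) (p : R) (V : {ffun 'I_n -> R}) : R :=
  (\sum_i `|V i| `^ p) `^ p^-1.

(* x^(1/q), with 1/q = 0 when q is infinite. *)
Definition root_ext (R : realType) (x : R) (q : \bar R) : R :=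
  match q with
  | EFin r => x `^ r^-1
  | _ => 1
  end.

(* 1/x^q for 0 < x < 1: x^q = 0 when q = +oo, so that 1/x^q is then +oo.
   The value at -oo is never used: a conjugate of p >= 1 is not -oo. *)
Definition inv_pow_ext (R : realType) (x : R) (q : \bar R) : \bar R :=
  match q with
  | EFin r => (1 / x `^ r)%:E
  | _ => +oo%E
  end.

(* Probability of the sample sequence s when its m entries are i.i.d. from A. *)
Definition iid_prob (R : realType) (n m : nat) (A : {ffun 'I_n -> R})
    (s : {ffun 'I_m -> 'I_n}) : R :=
  \prod_(j < m) A (s j).

(* A (possibly randomized) algorithm drawing m samples: to each sample sequence
   it associates the law of its output; the output true means "uniform" and
   false means "not uniform". Deterministic algorithms are those whose laws are
   all point masses. *)
Record algorithm (R : realType) (n m : nat) := Algorithm {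
  output_law :> {ffun 'I_m -> 'I_n} -> {ffun bool -> R};
  output_lawP : forall s, is_distribution (output_law s)
}.

Definition output_prob (R : realType) (n m : nat) (T : algorithm R n m)
    (A : {ffun 'I_n -> R}) (b : bool) : R :=
  \sum_(s : {ffun 'I_m -> 'I_n}) iid_prob A s * T s b.

Definition solves_uniformity_testing (R : realType) (n m : nat)
    (p eps delta : R) (T : algorithm R n m) : Prop :=
  forall A : {ffun 'I_n -> R}, is_distribution A ->
    (A = uniform R n -> 1 - delta <= output_prob T A true) /\
    (eps <= lp_norm p (A - uniform R n) ->
       1 - delta <= output_prob T A false).

Lemma hoelder_conjugate_gt1 (R : realType) (p : R) :
  1 < p -> hoelder_conjugate p%:E = (p / (p - 1))%:E.
Proof.
move=> p1; rewrite /hoelder_conjugate /= eqe gt_eqF ?(lt_trans ltr01)//.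
by rewrite -EFinB inver subr_eq0 gt_eqF.
Qed.

(* Main.v *)
(** Let [a = eps * n^(1/q)], so [a <= 1], and let the unknown distribution be
    [(1 + a h_i) / n], with [h] drawn from a random family of mean-zero vectors,
    bounded below by -1 and with [|h_i|] averaging 1.  Every such distribution is
    [eps]-far from uniform by convexity of [x^p].  A tester distinguishes the
    uniform law on samples from the mixture with advantage [x = 1 - 2 delta], so
    by Cauchy-Schwarz the second moment of the likelihood ratio is at least
    [1 + 4 x^2].  For two independent copies [h], [h'] it equals
    [E (1 + a^2 <h,h'> / n)^m <= E exp (m a^2 <h,h'> / n) <= exp (2 m^2 a^4 / n)].
    The claim follows from [1 + 4 x^2 >= (1 + x^2)^2].

    The vectors [h] are concatenations of independent blocks: pairs [+-(1, -1)]
    and, when [n] is odd, one triple, a random permutation of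
    [(3/2, -3/4, -3/4)].  The triple is less subgaussian than the pairs; the gap
    between [1 + 4 x^2] and [1 + x^2] absorbs the loss. *)
Require Import Defs.
From mathcomp Require Import all_boot all_order all_algebra.
From mathcomp Require Import reals ereal exp hoelder.
From mathcomp Require Import sequences ring lra.

Import Order.TTheory GRing.Theory Num.Theory.
Local Open Scope ring_scope.

(** * Exponential inequalities for one pair and for one triple *)

Lemma expR_le_inv (R : realType) (z : R) : z < 1 -> expR z <= (1 - z)^-1.
Proof.
move=> z1; rewrite -[z]opprK expRN opprK lef_pV2 ?posrE ?expR_gt0//; last by lra.
exact: expR_ge1Dx.
Qed.

(** Halving the exponent first improves the second-order term from [z^2] to [3/4 z^2]; with
    [expR_le_inv] alone the triple estimate would fail for small positive [u]. *)
Lemma expR_le_inv_sqr (R : realType) (z : R) :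
  z < 2 -> expR z <= ((1 - z / 2) ^+ 2)^-1.
Proof.
move=> z2; have -> : z = z / 2 + z / 2 by field.
rewrite expRD -!expr2 -exprVn ler_sqr ?nnegrE ?expR_ge0//; last first.
  by rewrite invr_ge0; lra.
have -> : 1 - (z / 2 + z / 2) / 2 = 1 - z / 2 by field.
by apply: expR_le_inv; lra.
Qed.

(** After division by [expR (y ^+ 2)], the rational bounds on the two terms sum to
    [(2 + 2 y^2) / (1 + y^2 + y^4)], which is at most 2. *)
Lemma cosh_subgaussian (R : realType) (y : R) :
  expR y + expR (- y) <= 2 * expR (y ^+ 2).
Proof.
have E (z : R) : expR z = expR (y ^+ 2) * expR (z - y ^+ 2).
  by rewrite -expRD; congr expR; ring.
rewrite (E y) (E (- y)) -mulrDr mulrC ler_pM2r ?expR_gt0//.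
have y2 : 0 <= y ^+ 2 by exact: sqr_ge0.
have a0 : 0 < 1 - (y - y ^+ 2) by nra.
have b0 : 0 < 1 - (- y - y ^+ 2) by nra.
apply: le_trans (lerD (expR_le_inv _ _ _) (expR_le_inv _ _ _)) _; [lra|lra|].
rewrite -subr_ge0.
have -> : 2 - ((1 - (y - y ^+ 2))^-1 + (1 - (- y - y ^+ 2))^-1) =
    2 * y ^+ 4 / ((1 - (y - y ^+ 2)) * (1 - (- y - y ^+ 2))).
  by field; rewrite ?gt_eqF.
have y4 : 0 <= y ^+ 4 by exact: exprn_even_ge0.
apply: divr_ge0; first by rewrite pmulr_rge0.
by rewrite mulr_ge0 ?(ltW a0) ?(ltW b0).
Qed.

Lemma triple_subgaussian (R : realType) (u : R) :
  expR (2 * u) + 2 * expR (- u) <= 3 * expR (2 * u ^+ 2).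
Proof.
have E (z : R) : expR z = expR (2 * u ^+ 2) * expR (z - 2 * u ^+ 2).
  by rewrite -expRD; congr expR; ring.
rewrite (E (2 * u)) (E (- u)) [2 * (_ * _)]mulrCA -mulrDr [leRHS]mulrC.
rewrite ler_pM2l ?expR_gt0//.
set a := 1 - u + u ^+ 2; set b := 1 + u / 2 + u ^+ 2.
have a0 : 0 < a by rewrite /a; nra.
have b0 : 0 < b by rewrite /b; nra.
have ha : expR (2 * u - 2 * u ^+ 2) <= (a ^+ 2)^-1.
  have -> : a = 1 - (2 * u - 2 * u ^+ 2) / 2 by rewrite /a; field.
  by apply: expR_le_inv_sqr; rewrite /a in a0; lra.
have hb : expR (- u - 2 * u ^+ 2) <= (b ^+ 2)^-1.
  have -> : b = 1 - (- u - 2 * u ^+ 2) / 2 by rewrite /b; field.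
  by apply: expR_le_inv_sqr; rewrite /b in b0; lra.
apply: (@le_trans _ _ ((a ^+ 2)^-1 + 2 * (b ^+ 2)^-1)); first by lra.
rewrite -subr_ge0.
have -> : 3 - ((a ^+ 2)^-1 + 2 * (b ^+ 2)^-1) =
    (3 * (a * b) ^+ 2 - b ^+ 2 - 2 * a ^+ 2) / (a * b) ^+ 2.
  by field; rewrite ?gt_eqF.
rewrite divr_ge0 ?sqr_ge0//.
(* Sum-of-squares certificate: factor out [u^2], then complete squares from the lowest degree up,
   each square absorbing the next odd-degree term. *)
have -> : 3 * (a * b) ^+ 2 - b ^+ 2 - 2 * a ^+ 2 =
    u ^+ 2 * (3 / 2 * (1 - 3 / 2 * u) ^+ 2
      + u ^+ 2 * (63 / 8 * (1 - 10 / 21 * u) ^+ 2)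
      + u ^+ 4 * (3 * (u - 1 / 2) ^+ 2 + 101 / 14)).
  by rewrite /a /b; field.
have u2 := sqr_ge0 u; have u4 : 0 <= u ^+ 4 by rewrite exprn_even_ge0.
have s1 := sqr_ge0 (1 - 3 / 2 * u); have s2 := sqr_ge0 (1 - 10 / 21 * u).
have s3 := sqr_ge0 (u - 1 / 2).
apply: mulr_ge0 => //; apply: addr_ge0; first apply: addr_ge0.
- by lra.
- by apply: mulr_ge0 => //; lra.
- by apply: mulr_ge0 => //; lra.
Qed.

(** * Random mean-zero vectors built from blocks *)

(* The last clause: [<h w, h w'>] is subgaussian for independent uniform [w], [w']. *)
Definition hard_family {R : realType} {Om : finType} (n : nat)
    (h : Om -> nat -> R) : Prop :=
  [/\ (0 < #|Om|)%N,
      forall w, \sum_(i < n) h w i = 0,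
      forall w i, - 1 <= h w i,
      forall w, \sum_(i < n) `|h w i| = n%:R &
      forall t, \sum_w \sum_w' expR (t * \sum_(i < n) h w i * h w' i)
        <= #|Om|%:R ^+ 2 * expR (2 * n%:R * t ^+ 2)].

Lemma hard_family_pair (R : realType) :
  hard_family 2 (fun (b : bool) i => if (i == 0%N) (+) b then 1 else - 1 : R).
Proof.
split.
- by rewrite card_bool.
- by move=> b; rewrite !big_ord_recl big_ord0; case: b => /=; ring.
- by move=> b i; case: (_ (+) _); lra.
- move=> b; rewrite !big_ord_recl big_ord0.
  by case: b => /=; rewrite ?normrN !normr1; ring.
- move=> t; rewrite !big_bool /= !big_ord_recl !big_ord0 /= card_bool.
  have := cosh_subgaussian R (2 * t).
  have -> : t * (-1 * -1 + (1 * 1 + 0)) = 2 * t by ring.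
  have -> : t * (1 * 1 + (-1 * -1 + 0)) = 2 * t by ring.
  have -> : t * (-1 * 1 + (1 * -1 + 0)) = - (2 * t) by ring.
  have -> : t * (1 * -1 + (-1 * 1 + 0)) = - (2 * t) by ring.
  have -> : 2 * 2 * t ^+ 2 = (2 * t) ^+ 2 by ring.
  by lra.
Qed.

Lemma hard_family_triple (R : realType) :
  hard_family 3 (fun (k : 'I_3) i =>
    if i == k :> nat then 3 / 2 else - (3 / 4) : R).
Proof.
have n1 : `|3 / 2 : R| = 3 / 2 by rewrite ger0_norm//; lra.
have n2 : `|- (3 / 4) : R| = 3 / 4 by rewrite normrN ger0_norm//; lra.
split.
- by rewrite card_ord.
- by move=> [[|[|[|//]]] ?]; rewrite !big_ord_recl big_ord0 /=; field.
- by move=> b i; case: ifP => _; lra.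
- by move=> [[|[|[|//]]] ?]; rewrite !big_ord_recl big_ord0 /= n1 n2; field.
(* Two triples have inner product [27/8] if equal and [-27/16] otherwise, hence the exponents [2 u]
   and [- u]. The bound closes because [2 (27/16)^2 = 729/128] is below [2 * 3]. *)
- move=> t; pose u := 27 / 16 * t.
  have -> : \sum_(w < 3) \sum_(w' < 3) expR (t * \sum_(i < 3)
     (if i == w :> nat then 3 / 2 else - (3 / 4))
       * (if i == w' :> nat then 3 / 2 else - (3 / 4)))
     = 3 * (expR (2 * u) + 2 * expR (- u)).
    have E (w w' : 'I_3) : t * \sum_(i < 3)
        (if i == w :> nat then 3 / 2 else - (3 / 4))
       * (if i == w' :> nat then 3 / 2 else - (3 / 4))
       = if w == w' then 2 * u else - u.
      rewrite -[w == w']/(w == w' :> nat).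
      by case: w w' => [[|[|[|//]]] ?] [[|[|[|//]]] ?];
        rewrite !big_ord_recl big_ord0 /u /= /=; field.
    under eq_bigr do under eq_bigr do rewrite E.
    by rewrite !big_ord_recl !big_ord0 /=; ring.
  rewrite card_ord expr2 -mulrA ler_pM2l//.
  apply: le_trans (triple_subgaussian R _) _.
  rewrite ler_pM2l// ler_expR /u.
  have := sqr_ge0 t; lra.
Qed.

(** Inner products add over independent blocks, so the exponential moment factors; the exponent
    allowed by [hard_family] is linear in [n], so the bounds multiply exactly. *)
Lemma hard_family_cat (R : realType) (Om1 Om2 : finType) (n1 n2 : nat)
    (h1 : Om1 -> nat -> R) (h2 : Om2 -> nat -> R) :
  hard_family n1 h1 -> hard_family n2 h2 ->
  hard_family (n1 + n2) (fun (w : Om1 * Om2) i =>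
    if (i < n1)%N then h1 w.1 i else h2 w.2 (i - n1)%N).
Proof.
move=> [c1 z1 l1 a1 e1] [c2 z2 l2 a2 e2].
have E1 (i : 'I_n1) : (i < n1)%N = true by rewrite ltn_ord.
have E2 (i : 'I_n2) : (n1 + i < n1)%N = false by rewrite ltnNge leq_addr.
split.
- by rewrite card_prod muln_gt0 c1.
- move=> w; rewrite big_split_ord /=.
  under eq_bigr do rewrite E1.
  rewrite z1 add0r.
  by under eq_bigr do rewrite E2 addKn.
- by move=> w i; case: ifP.
- move=> w; rewrite big_split_ord /= natrD -(a1 w.1) -(a2 w.2); congr (_ + _).
    by under eq_bigr do rewrite E1.
  by under eq_bigr do rewrite E2 addKn.
- move=> t.
  set S1 := fun w w' : Om1 => expR (t * \sum_(i < n1) h1 w i * h1 w' i).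
  set S2 := fun w w' : Om2 => expR (t * \sum_(i < n2) h2 w i * h2 w' i).
  rewrite (_ : \sum_w _ = (\sum_w \sum_w' S1 w w') * (\sum_w \sum_w' S2 w w')).
    rewrite card_prod natrM exprMn natrD.
    have -> : 2 * (n1%:R + n2%:R) * t ^+ 2
        = 2 * n1%:R * t ^+ 2 + 2 * n2%:R * t ^+ 2 :> R by ring.
    rewrite expRD mulrACA; apply: ler_pM; [ | | exact: e1 | exact: e2];
      by do 2!apply: sumr_ge0 => ? _; exact: expR_ge0.
  rewrite big_distrlr [RHS]pair_bigA /=; apply: eq_bigr => w _ /=.
  rewrite big_distrlr [RHS]pair_bigA /=; apply: eq_bigr => w' _ /=.
  rewrite big_split_ord /= mulrDr expRD; congr (expR (t * _) * expR (t * _)).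
    by apply: eq_bigr => i _; rewrite E1.
  by apply: eq_bigr => i _; rewrite E2 addKn.
Qed.

Lemma hard_family_exists (R : realType) (n : nat) : (2 <= n)%N ->
  exists (Om : finType) (h : Om -> nat -> R), hard_family n h.
Proof.
(* Induction in steps of two from the bases 2 and 3: a triple occurs only for odd [n], and once. *)
elim/ltn_ind: n => -[|[|[|[|n]]]] // IH _.
- by do 2!eexists; exact: hard_family_pair.
- by do 2!eexists; exact: hard_family_triple.
- have [//|//|Om [h hh]] := IH n.+2.
  by do 2!eexists; exact: (hard_family_cat _ _ _ _ _ _ _ (hard_family_pair R) hh).
Qed.

(** * From distinguishing advantage to second moment *)

(** Cauchy-Schwarz against the uniform law on [S]. Both laws have mass 1, so [f] can be centred at
    1/2; the bound 1/2 on the centred test gives the factor 4. *)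
Lemma advantage_le_chi2 (R : realType) (S : finType) (Q f : S -> R) (x : R) :
  (0 < #|S|)%N -> \sum_s Q s = 1 -> (forall s, 0 <= f s <= 1) -> 0 <= x ->
  x <= #|S|%:R^-1 * \sum_s f s - \sum_s Q s * f s ->
  1 + 4 * x ^+ 2 <= #|S|%:R * \sum_s Q s ^+ 2.
Proof.
move=> S0 Q1 f01 x0 hx; set N : R := #|S|%:R in hx *.
have N0 : 0 < N by rewrite ltr0n.
(* The constant term [(1 + 2 x)^2] is kept opaque so that [big_split] does not break it up. *)
have [c cE] : exists c, c = 1 + 4 * x + 4 * x ^+ 2 by eexists.
(* This is [0 <= (N Q - 1 + 4 x (f - 1/2))^2], using [(f - 1/2)^2 <= 1/4]. *)
have pt s : 0 <= N ^+ 2 * Q s ^+ 2 + (- 2 * N - 4 * x * N) * Q s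
    + 8 * x * N * (Q s * f s) - 8 * x * f s + c.
  rewrite cE; have := sqr_ge0 (N * Q s - 1 + 4 * x * (f s - 1 / 2)).
  have /andP[f0 f1] := f01 s.
  have : 0 <= x ^+ 2 * (f s * (1 - f s)).
    by rewrite mulr_ge0 ?sqr_ge0// mulr_ge0// subr_ge0.
  by lra.
have : 0 <= \sum_s (N ^+ 2 * Q s ^+ 2 + (- 2 * N - 4 * x * N) * Q s
    + 8 * x * N * (Q s * f s) - 8 * x * f s + c).
  by apply: sumr_ge0.
rewrite big_split sumrB !big_split /= -!mulr_sumr Q1 sumr_const -[_ *+ #|_|]mulr_natr.
have -> : #|[pred _ : S | true]|%:R = N by [].
have hN : N * x <= \sum_s f s - N * \sum_s Q s * f s.
  by rewrite -(ler_pM2l N0) mulrBr mulrA divff ?gt_eqF// mul1r in hx.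
have := ler_wpM2l x0 hN.
rewrite -[_ <= N * _](ler_pM2l N0).
by rewrite cE; lra.
Qed.

(** * Laws of i.i.d. samples and of the output *)

Lemma sum_iid_probM (R : realType) (n m : nat) (A B : {ffun 'I_n -> R}) :
  \sum_(s : {ffun 'I_m -> 'I_n}) iid_prob A s * iid_prob B s
    = (\sum_i A i * B i) ^+ m.
Proof.
rewrite -[in RHS](card_ord m) -prodr_const bigA_distr_bigA.
by apply: eq_bigr => s _; rewrite -big_split.
Qed.

Lemma sum_iid_prob (R : realType) (n m : nat) (A : {ffun 'I_n -> R}) :
  \sum_(s : {ffun 'I_m -> 'I_n}) iid_prob A s = (\sum_i A i) ^+ m.
Proof.
by rewrite -[in RHS](card_ord m) -prodr_const bigA_distr_bigA.
Qed.

Lemma output_prob_true_false (R : realType) (n m : nat) (T : algorithm R n m)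
    (A : {ffun 'I_n -> R}) : is_distribution A ->
  output_prob T A true + output_prob T A false = 1.
Proof.
move=> [_ A1]; rewrite -big_split -(expr1n _ m) -A1 -sum_iid_prob.
apply: eq_bigr => s _ /=; rewrite -mulrDr.
by have [_] := output_lawP T s; rewrite big_bool => ->; rewrite mulr1.
Qed.

Lemma uniform_distribution (R : realType) (n : nat) :
  (0 < n)%N -> is_distribution (uniform R n).
Proof.
move=> n0; split=> [i|]; first by rewrite ffunE invr_ge0.
under eq_bigr do rewrite ffunE.
by rewrite sumr_const card_ord -[_ *+ n]mulr_natr mulVf// pnatr_eq0 -lt0n.
Qed.

(** * Perturbed distributions and their distance from uniform *)

Definition perturbed_uniform {R : realType} (n : nat) (a : R) (h : nat -> R) :
  {ffun 'I_n -> R} := [ffun i : 'I_n => (1 + a * h i) / n%:R].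

Lemma perturbed_uniform_distribution (R : realType) (n : nat) (a : R)
    (h : nat -> R) :
  (0 < n)%N -> 0 <= a <= 1 -> (forall i, - 1 <= h i) ->
  \sum_(i < n) h i = 0 -> is_distribution (perturbed_uniform n a h).
Proof.
move=> n0 /andP[a0 a1] h1 hs; split=> [i|].
  by rewrite ffunE divr_ge0//; have := h1 i; nra.
under eq_bigr do rewrite ffunE.
rewrite -mulr_suml big_split /= -mulr_sumr hs mulr0 addr0 sumr_const card_ord.
by rewrite divff// pnatr_eq0 -lt0n.
Qed.

(** For [p > 1] this is Young's inequality for the product of [x] and 1, multiplied by [p]. *)
Lemma powR_ge_tangent (R : realType) (p x : R) : 1 <= p -> 0 <= x ->
  1 + p * (x - 1) <= x `^ p.
Proof.
move=> p1 x0; have [->|pn1] := eqVneq p 1.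
  by rewrite powRr1//; lra.
have p1' : 1 < p by rewrite lt_neqAle eq_sym pn1.
have q0 : 0 < p / (p - 1) by rewrite divr_gt0//; lra.
have p0 : 0 < p by lra.
have pq : (p / (p - 1))^-1 = 1 - p^-1 by field; lra.
have := @conjugate_powR R x 1 p (p / (p - 1)) x0 ler01 p0 q0.
rewrite pq subrKC powR1 mulr1 mul1r => /(_ erefl).
rewrite -(ler_pM2l p0) mulrDr mulrCA mulrBr !divff ?gt_eqF// mulr1; lra.
Qed.

Lemma lp_norm_perturbed (R : realType) (n : nat) (p a : R) (h : nat -> R) :
  (0 < n)%N -> 1 <= p -> 0 <= a -> \sum_(i < n) `|h i| = n%:R ->
  a / n%:R * n%:R `^ p^-1 <= lp_norm p (perturbed_uniform n a h - uniform R n).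
Proof.
move=> n0 p1 a0 hs; rewrite /lp_norm.
have p0 : 0 < p by lra.
have an0 : 0 <= a / n%:R by rewrite divr_ge0.
have E (i : 'I_n) : `|(perturbed_uniform n a h - uniform R n) i| `^ p
    = (a / n%:R) `^ p * `|h i| `^ p.
  rewrite !ffunE -powRM//; congr (_ `^ _).
  rewrite -[X in X * `|h i|]ger0_norm// -normrM; congr `|_|; field.
  by rewrite pnatr_eq0 -lt0n.
under eq_bigr do rewrite E.
have S0 : 0 <= \sum_(i < n) `|h i| `^ p.
  by apply: sumr_ge0 => i _; exact: powR_ge0.
rewrite -mulr_sumr powRM ?powR_ge0//.
rewrite -powRrM divff ?gt_eqF// powRr1//.
apply: ler_wpM2l => //; apply: ge0_ler_powR; rewrite ?nnegrE ?invr_ge0 ?(ltW p0)//.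
(* The linear terms of the tangents cancel because [|h i|] averages 1, which leaves [n]. *)
apply: (@le_trans _ _ (\sum_(i < n) (1 + p * (`|h i| - 1)))); last first.
  by apply: ler_sum => i _; exact: powR_ge_tangent.
by rewrite big_split /= -mulr_sumr sumrB hs sumr_const card_ord subrr mulr0 addr0.
Qed.

(** * Second moment of the likelihood ratio of the mixture *)

Definition mixture_prob {R : realType} {Om : finType} {n m : nat}
    (A : Om -> {ffun 'I_n -> R}) (s : {ffun 'I_m -> 'I_n}) : R :=
  #|Om|%:R^-1 * \sum_w iid_prob (A w) s.

Lemma mixture_chi2 (R : realType) (Om : finType) (n m : nat) (a : R)
    (h : Om -> nat -> R) : (0 < n)%N -> 0 <= a <= 1 -> hard_family n h ->
  (n ^ m)%:R * \sum_(s : {ffun 'I_m -> 'I_n})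
      mixture_prob (fun w => perturbed_uniform n a (h w)) s ^+ 2
    <= expR (2 * (m%:R * a ^+ 2) ^+ 2 / n%:R).
Proof.
move=> n0 a01 [c hs h1 _ he].
have nn0 : n%:R != 0 :> R by rewrite pnatr_eq0 -lt0n.
have N0 : 0 < #|Om|%:R :> R by rewrite ltr0n.
set A := fun w => perturbed_uniform n a (h w).
(* Squaring the average gives pairs [w], [w']; for each pair the sum over sample sequences is an
   [m]-th power. *)
have -> : (n ^ m)%:R * \sum_(s : {ffun 'I_m -> 'I_n}) mixture_prob A s ^+ 2
    = #|Om|%:R ^- 2 * \sum_w \sum_w' (n%:R * \sum_i A w i * A w' i) ^+ m.
  under [in RHS]eq_bigr do under eq_bigr do
    rewrite exprMn -sum_iid_probM mulr_sumr.
  under [in RHS]eq_bigr do rewrite exchange_big /=.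
  rewrite [in RHS]exchange_big /= !mulr_sumr; apply: eq_bigr => s _.
  rewrite /mixture_prob exprMn mulrCA exprVn; congr (_ * _).
  rewrite expr2 big_distrlr mulr_sumr; apply: eq_bigr => w _ /=.
  by rewrite mulr_sumr; apply: eq_bigr => w' _; rewrite natrX.
rewrite mulrC ler_pdivrMr ?exprn_gt0//.
apply: (@le_trans _ _ (\sum_w \sum_w'
    expR (m%:R * a ^+ 2 / n%:R * \sum_(i < n) h w i * h w' i))).
  apply: ler_sum => w _; apply: ler_sum => w' _.
  (* Terms linear in [h] vanish by mean zero. Then [1 + z <= expR z] is raised to the power [m],
     which is legitimate since the left side is nonnegative. *)
  have E : n%:R * \sum_i A w i * A w' i
      = 1 + a ^+ 2 / n%:R * \sum_(i < n) h w i * h w' i.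
    have -> : n%:R * (\sum_i A w i * A w' i) = n%:R^-1 * \sum_(i < n)
        (1 + a * h w i + a * h w' i + a ^+ 2 * (h w i * h w' i)).
      rewrite !mulr_sumr; apply: eq_bigr => i _.
      by rewrite !ffunE; field.
    rewrite !big_split /= -!mulr_sumr !hs sumr_const card_ord.
    by rewrite !mulr0 !addr0 mulrDr mulVf// mulrA [_^-1 * _]mulrC.
  rewrite -2!mulrA expRM_natl mulrA.
  apply: lerXn2r; rewrite ?nnegrE ?expR_ge0//; last by rewrite E expR_ge1Dx.
  rewrite mulr_ge0 ?sumr_ge0// => i _.
  by rewrite mulr_ge0//; apply perturbed_uniform_distribution.
(* The subgaussian clause at [t = m a^2 / n], where [2 n t^2 = 2 (m a^2)^2 / n]. *)
apply: le_trans (he _) _; rewrite mulrC; set X := expR _; set Y := expR _.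
suff -> : X = Y by [].
by congr expR; field.
Qed.

(** Acceptance probability is linear in the law of the samples: at least [1 - delta] under uniform
    and at most [delta] under the mixture, so the advantage is [1 - 2 delta]. *)
Lemma tester_chi2 (R : realType) (Om : finType) (n m : nat) (p eps delta : R)
    (T : algorithm R n m) (A : Om -> {ffun 'I_n -> R}) :
  (0 < n)%N -> (0 < #|Om|)%N -> delta <= 1 / 2 ->
  solves_uniformity_testing p eps delta T ->
  (forall w, is_distribution (A w)) ->
  (forall w, eps <= lp_norm p (A w - uniform R n)) ->
  1 + 4 * (1 - 2 * delta) ^+ 2
    <= (n ^ m)%:R * \sum_(s : {ffun 'I_m -> 'I_n}) mixture_prob A s ^+ 2.
Proof.
move=> n0 c hd hT hA hfar.
have N0 : 0 < #|Om|%:R :> R by rewrite ltr0n.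
have cE : #|{ffun 'I_m -> 'I_n}| = (n ^ m)%N by rewrite card_ffun !card_ord.
rewrite -cE; apply: (@advantage_le_chi2 _ _ _ (fun s => T s true)).
- by rewrite cE expn_gt0 n0.
- rewrite -mulr_sumr exchange_big /=.
  under eq_bigr do rewrite sum_iid_prob (proj2 (hA _)) expr1n.
  by rewrite sumr_const mulVf// gt_eqF.
- move=> s; have [T0] := output_lawP T s; rewrite big_bool /=.
  by have := T0 true; have := T0 false; lra.
- by lra.
have U := uniform_distribution R n n0.
have -> : #|{ffun 'I_m -> 'I_n}|%:R^-1 * \sum_s T s true
    = output_prob T (uniform R n) true.
  rewrite cE mulr_sumr; apply: eq_bigr => s _; congr (_ * _).
  rewrite /iid_prob; under eq_bigr do rewrite ffunE.
  by rewrite prodr_const card_ord exprVn natrX.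
have -> : \sum_s mixture_prob A s * T s true
    = #|Om|%:R^-1 * \sum_w output_prob T (A w) true.
  rewrite /output_prob exchange_big mulr_sumr; apply: eq_bigr => s _ /=.
  by rewrite -mulrA mulr_suml.
have hU := (hT _ U).1 erefl.
suff : #|Om|%:R^-1 * \sum_w output_prob T (A w) true <= delta by lra.
rewrite mulrC ler_pdivrMr// mulr_natr -sumr_const; apply: ler_sum => w _.
have := output_prob_true_false _ _ _ T _ (hA w).
by have := (hT _ (hA w)).2 (hfar w); lra.
Qed.

(** * Choice of the perturbation size and conclusion *)

(** The upper bound on [n] says exactly that the perturbation size is at most 1; [1/p + 1/q = 1]
    then makes the distance from [lp_norm_perturbed] equal to [eps]. *)
Lemma conjugate_scale (R : realType) (p eps : R) (q : \bar R) (n : nat) :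
  1 <= p -> q = hoelder_conjugate p%:E -> 0 < eps <= 1 -> (0 < n)%N ->
  (n%:R%:E <= inv_pow_ext eps q)%E ->
  0 < eps * root_ext n%:R q <= 1 /\
  eps * root_ext n%:R q / n%:R * n%:R `^ p^-1 = eps.
Proof.
move=> p1 -> /andP[e0 e1] n0.
have nn0 : 0 < n%:R :> R by rewrite ltr0n.
have [->|pn1] := eqVneq p 1.
  rewrite hoelder_conjugate1 /= mulr1 e0 e1 invr1 powRr1 ?(ltW nn0)// => _.
  by split => //; field; rewrite gt_eqF.
have p1' : 1 < p by rewrite lt_neqAle eq_sym pn1.
rewrite hoelder_conjugate_gt1//; set r := p / (p - 1).
have r0 : 0 < r by rewrite divr_gt0//; lra.
have er : 0 < eps `^ r by rewrite powR_gt0.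
rewrite /= lee_fin ler_pdivlMr// => hn; split.
  rewrite mulr_gt0 ?powR_gt0//=.
  have -> : eps = (eps `^ r) `^ r^-1.
    by rewrite -powRrM divff ?gt_eqF// powRr1// ltW.
  rewrite -powRM ?powR_ge0//.
  apply: (@le_trans _ _ (1 `^ r^-1)); last by rewrite powR1.
  rewrite mulrC; apply: ge0_ler_powR => //; rewrite ?nnegrE ?mulr_ge0 ?powR_ge0//.
  by rewrite invr_ge0 ltW.
rewrite mulrAC -[eps * _ * _]mulrA -powRD ?(gt_eqF nn0) ?implybT//.
have -> : r^-1 + p^-1 = 1 by rewrite /r; field; lra.
by rewrite powRr1 ?mulfK ?gt_eqF// ltW.
Qed.

Theorem theorem12 (R : realType) (p : R) (q : \bar R) (eps delta : R) (n m : nat)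
    (T : algorithm R n m)
    (hp : 1 <= p <= 2)
    (hq : q = hoelder_conjugate p%:E)
    (heps : 0 < eps < 1)
    (hdelta : 0 < delta < 1 / 2)
    (hn : (2 <= n)%N)
    (hnq : (n%:R%:E <= inv_pow_ext eps q)%E)
    (hT : solves_uniformity_testing p eps delta T) :
  Num.sqrt (ln ((1 - 2 * delta) ^+ 2 + 1))
    * (Num.sqrt n%:R / (eps * root_ext n%:R q) ^+ 2) <= m%:R.
Proof.
have [p1 _] := andP hp; have [e0 e1] := andP heps; have [d0 d1] := andP hdelta.
have n0 : (0 < n)%N by apply: leq_trans hn.
have nn0 : 0 < n%:R :> R by rewrite ltr0n.
have e01 : 0 < eps <= 1 by rewrite e0 ltW.
have [] := conjugate_scale R p eps q n p1 hq e01 n0 hnq.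
set a := eps * root_ext n%:R q => /andP[a0 a1] aE.
have a01 : 0 <= a <= 1 by rewrite ltW.
have [Om [h hh]] := hard_family_exists R n hn.
have chi2 := mixture_chi2 R Om n m a h n0 a01 hh.
have [c hs h1 habs _] := hh.
have hA w : is_distribution (perturbed_uniform n a (h w)).
  exact: perturbed_uniform_distribution.
have hfar w : eps <= lp_norm p (perturbed_uniform n a (h w) - uniform R n).
  by rewrite -[leLHS]aE lp_norm_perturbed// ltW.
have lower := tester_chi2 R Om n m p eps delta T _ n0 c (ltW d1) hT hA hfar.
have {chi2 lower} := le_trans lower chi2.
set x := 1 - 2 * delta => hx.
set y := x ^+ 2 + 1.
have y0 : 0 < y by rewrite /y ltr_wpDl ?sqr_ge0.
have x01 : 0 <= x ^+ 2 <= 1.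
  by rewrite sqr_ge0 expr2 mulr_ile1// /x; lra.
have Lm : ln y * n%:R <= (m%:R * a ^+ 2) ^+ 2.
  rewrite -ler_pdivlMr//.
  (* Exponentiating turns [2 * ln y] into [y^2 = 1 + 2 x^2 + x^4], at most [1 + 4 x^2] because
     [x^2 <= 1]. *)
  suff : 2 * ln y <= 2 * (m%:R * a ^+ 2) ^+ 2 / n%:R by rewrite -mulrA ler_pM2l.
  rewrite -ler_expR expRM_natl lnK ?posrE//.
  by apply: le_trans hx; rewrite /y; nra.
rewrite mulrA ler_pdivrMr ?exprn_gt0//.
have L0 : 0 <= ln y by rewrite ln_ge0// /y lerDr sqr_ge0.
have ma0 : 0 <= m%:R * a ^+ 2 by rewrite mulr_ge0 ?sqr_ge0.
rewrite -sqrtrM// -[leRHS]ger0_norm//.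
by rewrite -sqrtr_sqr ler_wsqrtr.
Qed.
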